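(* Each of the four semigroup varieties defined (within all semigroups) by one of the following identity systems is a modular but not cancellable element of the lattice $\mathbb{SEM}$ of all semigroup varieties: (i) $xyz\approx zyx$, $x^2y\approx 0$; (ii) $xyz\approx yzx$, $x^2y\approx 0$; (iii) $xyz\approx yxz$, $xyzt\approx xzty$, $xy^2\approx 0$; (iv) $xyz\approx xzy$, $xyzt\approx yzxt$, $x^2y\approx 0$.
   Context: $\mathbb{SEM}$ denotes the lattice of all semigroup varieties ordered by inclusion (meet is intersection; join is the least variety containing both). An element $x$ of a lattice $L$ is called modular if for all $y,z\in L$, $y\le z$ implies $(x\vee y)\wedge z=(x\wedge z)\vee y$; it is called cancellable if for all $y,z\in L$, $x\vee y=x\vee z$ and $x\wedge y=x\wedge z$ imply $y=z$. For a word $\mathbf u$, the expression $\mathbf u\approx 0$ is short for the pair of identities $s\mathbf u\approx\mathbf us\approx\mathbf u$, where $s$ is a letter not occurring in $\mathbf u$. *)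

(* Defs.v *)
From HB Require Import structures.
From mathcomp Require Import all_boot all_order.
From mathcomp Require Import boolp classical_sets.

Set Implicit Arguments.
Unset Strict Implicit.
Unset Printing Implicit Defensive.

Import Order.TTheory.
Local Open Scope group_scope.

(* The word with first letter i followed by the letters of s is the pair      *)
(* (i, s): words are nonempty, and letters are natural numbers.               *)
Definition word : Type := (nat * seq nat)%type.
HB.instance Definition _ := Choice.on word.

Definition letter (i : nat) : word := (i, [::]).
Definition cat_word (u v : word) : word := (u.1, u.2 ++ v.1 :: v.2).

Lemma cat_wordA : associative cat_word.
Proof. by move=> u v w; rewrite /cat_word /= -catA. Qed.

(* word is the free semigroup on nat; its product is written u * v.           *)
HB.instance Definition _ := isSemigroup.Build word cat_wordA.

Definition eval (S : semigroupType) (f : nat -> S) (w : word) : S :=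
  foldl (fun a i => a * f i) (f w.1) w.2.

Definition identity : Type := (word * word)%type.

Notation "u ≈ v" := ((u, v) : identity) (at level 70, no associativity).

Definition satisfies (S : semigroupType) (e : identity) : Prop :=
  forall f : nat -> S, eval f e.1 = eval f e.2.

(* The elements of semigroupType, but with carriers in a smaller universe:    *)
(* classes of them then form a type small enough to be a latticeType.         *)
(* Classically each type is a choiceType, so every semigroup is covered.      *)
Record semigroup := Semigroup_of {
  carrier : Type;
  semigroup_class : Semigroup carrier
}.

Coercion semigroupType_of (S : semigroup) : semigroupType :=
  Semigroup.Pack (semigroup_class S).

Definition models (E : set identity) (S : semigroup) : Prop :=
  forall e, E e -> satisfies S e.

Definition fresh (u : word) : nat := (foldr maxn u.1 u.2).+1.

(* u ≈ 0 abbreviates s u ≈ u s ≈ u, where s does not occur in u.              *)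
Definition zero_identities (u : word) : seq identity :=
  let s := letter (fresh u) in [:: s * u ≈ u * s; u * s ≈ u].

Lemma fresh_notin (u : word) : fresh u \notin u.1 :: u.2.
Proof.
suff H i : i \in u.1 :: u.2 -> i < fresh u.
  by apply/negP => /H; rewrite ltnn.
case: u => a s /=; rewrite /fresh ltnS /= inE.
elim: s => [|b s IH] /=; first by rewrite in_nil orbF => /eqP->.
rewrite inE leq_max orbCA => /orP[/eqP->|/IH ->]; first by rewrite leqnn.
by rewrite orbT.
Qed.

(* As no identity excludes it, the empty semigroup lies in every variety.     *)
(* Discarding it from all of them gives an isomorphic lattice.                *)
Record SEM := Variety {
  variety_class :> semigroup -> Prop;
  variety_equational : exists E, variety_class = models E
}.

HB.instance Definition _ := gen_eqMixin SEM.
HB.instance Definition _ := gen_choiceMixin SEM.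

Section SEMLattice.

Implicit Types (V W X : SEM) (S : semigroup).

Definition SEM_le V W : bool := `[< forall S, V S -> W S >].

Lemma SEM_le_refl : reflexive SEM_le.
Proof. by move=> V; apply/asboolP. Qed.

Lemma SEM_le_anti : antisymmetric SEM_le.
Proof.
move=> V W /andP[/asboolP VW /asboolP WV].
have {VW WV} : variety_class V = variety_class W.
  by apply/funext => S; apply/propext; split=> [/VW|/WV].
case: V W => [V HV] [W HW] /= VW; subst W.
by congr Variety; apply: Prop_irrelevance.
Qed.

Lemma SEM_le_trans : transitive SEM_le.
Proof.
move=> W V X /asboolP VW /asboolP WX; apply/asboolP => S VS.
exact/WX/VW.
Qed.

Definition SEM_meet_class V W S : Prop := V S /\ W S.

Lemma SEM_meet_equational V W : exists E, SEM_meet_class V W = models E.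
Proof.
have [E VE] := variety_equational V; have [F WF] := variety_equational W.
exists (E `|` F)%classic; apply/funext => S; apply/propext.
rewrite /SEM_meet_class VE WF; split=> [[SE SF] e [/SE|/SF]//|SEF].
by split=> e He; apply: SEF; [left|right].
Qed.

Definition SEM_meet V W : SEM := Variety (SEM_meet_equational V W).

(* The least variety containing V and W.                                      *)
Definition SEM_join_class V W S : Prop :=
  forall X, (forall T, V T -> X T) -> (forall T, W T -> X T) -> X S.

Lemma SEM_join_equational V W : exists E, SEM_join_class V W = models E.
Proof.
pose E : set identity :=
  [set e | forall S, SEM_join_class V W S -> satisfies S e]%classic.
exists E; apply/funext => S; apply/propext.
split=> [VWS e Ee|ES X VX WX]; first exact: Ee.
have [F XF] := variety_equational X.
rewrite XF => e Fe; apply: ES => T VWT.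
by have := VWT X VX WX; rewrite XF; apply.
Qed.

Definition SEM_join V W : SEM := Variety (SEM_join_equational V W).

Lemma SEM_meetP X V W :
  SEM_le X (SEM_meet V W) = SEM_le X V && SEM_le X W.
Proof.
apply/asboolP/andP => [XVW|[/asboolP XV /asboolP XW] S XS]; last first.
  by split; [apply: XV|apply: XW].
by split; apply/asboolP => S /XVW[].
Qed.

Lemma SEM_joinP V W X :
  SEM_le (SEM_join V W) X = SEM_le V X && SEM_le W X.
Proof.
apply/asboolP/andP => [VWX|[/asboolP VX /asboolP WX] S]; last exact.
by split; apply/asboolP => S HS; apply: VWX => Y VY WY; [apply: VY|apply: WY].
Qed.

End SEMLattice.

Fact SEM_display : Order.disp_t. Proof. exact: Order.Disp tt tt. Qed.

HB.instance Definition _ := Order.Le_isPOrder.Build SEM_display SEM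
  SEM_le_refl SEM_le_anti SEM_le_trans.
HB.instance Definition _ := Order.POrder_MeetJoin_isLattice.Build
  SEM_display SEM SEM_meetP SEM_joinP.

Definition defined_by (s : seq identity) : SEM :=
  Variety (ex_intro _ [set e | e \in s]%classic erefl).

Section SpecialElements.

Context (d : Order.disp_t) (L : latticeType d).
Local Open Scope order_scope.

Definition modular (x : L) : Prop :=
  forall y z : L, y <= z -> (x `|` y) `&` z = (x `&` z) `|` y.

Definition cancellable (x : L) : Prop :=
  forall y z : L, x `|` y = x `|` z -> x `&` y = x `&` z -> y = z.

End SpecialElements.

(* Main.v *)
Require Import Defs.
From HB Require Import structures.
From mathcomp Require Import all_boot all_order.
From mathcomp Require Import boolp classical_sets.
From mathcomp Require Import all_fingroup zify.

Set Implicit Arguments.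
Unset Strict Implicit.
Unset Printing Implicit Defensive.

Import Order.TTheory.
Local Open Scope group_scope.

(* SEM is anti-isomorphic to the lattice of fully invariant congruences on the
   free semigroup.  For each of the four varieties the congruence nu collapses
   the null words to one class and identifies two linear words of length >= 4
   as soon as they have the same letters; apart from that it only permutes
   linear words of length 3, by a proper nontrivial subgroup G of S_3.

   Modularity: let beta <= alpha be fully invariant and u, v be joined by a
   chain of nu- and beta-steps.  If the chain meets a word that beta relates to
   a null word, then so do u and v, and a single nu-step is enough.  Otherwise
   all nu-steps in it permute the same letters: a beta-step that loses a letter
   leads to a null word once this letter is squared.  For length >= 4 one
   nu-step is again enough; for length 3 the modular law of the subgroup
   lattice of S_3 applies.

   Failure of cancellability: two distinct subgroups of order 2 of S_3 that
   are not G have the same join and the same meet with G; each of them defines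
   a variety in which all other words of length >= 3 are zero. *)

(** * Words, evaluations and fully invariant congruences *)

Definition letters (w : word) : seq nat := w.1 :: w.2.
Coercion letters : word >-> list.

Lemma letters_inj : injective letters.
Proof. by case=> [a s] [b t] [-> ->]. Qed.

Lemma letters_mul (u v : word) : letters (u * v) = u ++ v.
Proof. by []. Qed.

Lemma eval_rcons (S : semigroupType) (f : nat -> S) i s x :
  eval f (i, rcons s x) = eval f (i, s) * f x.
Proof. by rewrite /eval /= foldl_rcons. Qed.

Lemma mul_rcons (u : word) i s x :
  u * ((i, rcons s x) : word) = (u.1, rcons (u.2 ++ i :: s) x).
Proof. by apply: letters_inj; rewrite /letters /= rcons_cat. Qed.

Lemma eval_mul (S : semigroupType) (f : nat -> S) (u v : word) :
  eval f (u * v) = eval f u * eval f v.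
Proof.
case: v => j t; elim/last_ind: t => [|t x IH].
  by rewrite /eval /= foldl_cat.
by rewrite mul_rcons !eval_rcons mulgA -IH.
Qed.

Lemma eval_eval (S : semigroupType) (f : nat -> S) (g : nat -> word)
    (w : word) : eval f (eval g w) = eval (fun i => eval f (g i)) w.
Proof.
case: w => j t; elim/last_ind: t => [//|t x IH].
by rewrite !eval_rcons eval_mul IH.
Qed.

Lemma letters_eval (f : nat -> word) (w : word) :
  letters (eval f w) = flatten [seq letters (f i) | i <- w].
Proof.
case: w => a s; elim/last_ind: s => [|s x IH]; first by rewrite /= cats0.
move: IH; rewrite /eval /= -cats1 foldl_cat map_cat flatten_cat /= cats0.
by move=> IH; rewrite letters_mul IH catA.
Qed.

Lemma eval_rename (s : nat -> nat) (w : word) :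
  letters (eval (fun i => letter (s i)) w) = map s w.
Proof. by rewrite letters_eval; elim: (letters w) => //= a t ->. Qed.

Lemma eval_letter (w : word) : eval letter w = w.
Proof.
by apply: letters_inj; rewrite (eval_rename id) map_id.
Qed.

(** Fully invariant congruences on the free semigroup, whose endomorphisms are the maps [eval f]. *)
Record fic (R : word -> word -> Prop) : Prop := Fic {
  fic_refl : forall u, R u u;
  fic_sym : forall u v, R u v -> R v u;
  fic_trans : forall v u w, R u v -> R v w -> R u w;
  fic_mull : forall w u v, R u v -> R (w * u) (w * v);
  fic_mulr : forall w u v, R u v -> R (u * w) (v * w);
  fic_eval : forall (f : nat -> word) u v, R u v -> R (eval f u) (eval f v) }.

Definition eqs (V : SEM) (u v : word) : Prop :=
  forall S, V S -> satisfies S (u ≈ v).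

Lemma satisfies_fic (S : semigroup) : fic (fun u v => satisfies S (u ≈ v)).
Proof.
rewrite /satisfies /=; split=> [u f|u v uv f|v u w uv vw f|w u v uv f
  |w u v uv f|f u v uv g] //.
- by rewrite uv vw.
- by rewrite !eval_mul uv.
- by rewrite !eval_mul uv.
- by rewrite !eval_eval uv.
Qed.

Lemma eqs_fic V : fic (eqs V).
Proof.
split=> [u|u v uv|v u w uv vw|w u v uv|w u v uv|f u v uv] S VS.
- exact: (fic_refl (satisfies_fic S)).
- exact/(fic_sym (satisfies_fic S))/uv.
- exact: (fic_trans (satisfies_fic S) (uv S VS) (vw S VS)).
- exact/(fic_mull (satisfies_fic S))/uv.
- exact/(fic_mulr (satisfies_fic S))/uv.
- exact/(fic_eval (satisfies_fic S))/uv.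
Qed.

(** * Quotients of the free semigroup *)

Section FreeModel.

Variables (R : word -> word -> Prop) (Rfic : fic R).

(** A chosen representative of the class of [w], so that the quotient by [R] lives on a subtype of
    [word]. The default [letter 0] is never returned, as the class contains [w]. *)
Definition canon (w : word) : word := xget (letter 0) [set v | R w v]%classic.

Lemma canonP w : R w (canon w).
Proof.
by rewrite /canon; case: xgetP => [v _ //|] /(_ w); case; apply: fic_refl.
Qed.

Lemma canon_eq u v : canon u = canon v <-> R u v.
Proof.
split=> [uv|uv].
  apply: (fic_trans Rfic (canonP u)); rewrite uv.
  exact/(fic_sym Rfic)/canonP.
rewrite /canon; congr xget; apply/funext => w; apply/propext; split=> uw.
  exact: fic_trans (fic_sym Rfic uv) uw.
exact: fic_trans uv uw.
Qed.

Lemma canonK w : canon (canon w) = canon w.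
Proof. exact/canon_eq/(fic_sym Rfic)/canonP. Qed.

Definition free_carrier := {w : word | canon w == w}.
HB.instance Definition _ := Choice.on free_carrier.

Definition free_class (w : word) : free_carrier :=
  exist (fun v => canon v == v) (canon w) (introT eqP (canonK w)).

Definition free_mul (p q : free_carrier) := free_class (val p * val q).

Lemma free_mulA : associative free_mul.
Proof.
move=> p q r; apply: val_inj => /=; apply/canon_eq.
apply: (@fic_trans _ Rfic (val p * (val q * val r))).
  exact/(fic_sym Rfic)/(fic_mull Rfic)/canonP.
rewrite mulgA; exact/(fic_mulr Rfic)/canonP.
Qed.

HB.instance Definition _ := isSemigroup.Build free_carrier free_mulA.

Definition free_model : semigroup :=
  @Semigroup_of free_carrier (Semigroup.class free_carrier).

Lemma val_eval_free (f : nat -> free_carrier) (w : word) :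
  val (eval f w) = canon (eval (fun i => val (f i)) w).
Proof.
rewrite /eval; elim/last_ind: w.2 => [|s x IH] /=.
  by rewrite (eqP (valP (f w.1))).
rewrite -!cats1 !foldl_cat /= IH; apply/canon_eq/(fic_mulr Rfic).
exact/(fic_sym Rfic)/canonP.
Qed.

(** Evaluating each letter at its own class turns an identity of the quotient into a pair in [R].
    Conversely, a valuation in the quotient lifts to a substitution, and [R] is closed under
    substitutions. *)
Lemma free_modelP u v : satisfies free_model (u ≈ v) <-> R u v.
Proof.
split=> [uv|uv f]; last first.
  by apply: val_inj; rewrite !val_eval_free; apply/canon_eq/(fic_eval Rfic).
have /(congr1 val) := uv (fun i => free_class (letter i)).
rewrite !val_eval_free => /canon_eq.
suff H w : R (eval (fun i => val (free_class (letter i))) w) w.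
  move=> uv'; apply: (fic_trans Rfic (fic_sym Rfic (H u))).
  exact: fic_trans uv' (H v).
rewrite -[X in R _ X]eval_letter /eval.
elim/last_ind: w.2 => [|s x IH] /=; first exact/(fic_sym Rfic)/canonP.
rewrite -!cats1 !foldl_cat /=.
apply: (fic_trans Rfic (fic_mulr Rfic _ IH)); apply: (fic_mull Rfic).
exact/(fic_sym Rfic)/canonP.
Qed.

(** Completeness of equational logic: the quotient by [R] satisfies [E], hence lies in [V]. *)
Lemma eqs_sub (V : SEM) (E : set identity) u v :
  variety_class V = models E -> (forall e, E e -> R e.1 e.2) ->
  eqs V u v -> R u v.
Proof.
move=> VE ER uv; apply/free_modelP/uv; rewrite VE => -[a b] /ER.
by move/free_modelP.
Qed.

End FreeModel.

(** * Modularity *)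

(** As the letters of [u] are distinct, sending the letter at each position of [u] to the one at the
    same position of [v] is well defined. *)
Lemma rename_perm (u v : word) : uniq u -> perm_eq u v ->
  exists s, v = eval (fun i => letter (s i)) u.
Proof.
move=> uu uv; exists (fun i => nth 0 v (index i u)); apply: letters_inj.
rewrite (eval_rename (fun i => nth 0 v (index i u))).
apply: (@eq_from_nth _ 0) => [|k kv]; first by rewrite size_map (perm_size uv).
by rewrite (nth_map 0) ?(perm_size uv)// index_uniq ?(perm_size uv).
Qed.

(** * Linear words of length three and subgroups of S_3 *)

Definition perm_word (p : 'S_3) : word :=
  (val (p ord0), [:: val (p (inord 1)); val (p (inord 2))]).

Lemma letters_perm_word p :
  letters (perm_word p) = [seq val (p (inord i)) | i <- iota 0 3].
Proof.
rewrite /perm_word /letters /=; congr (_ :: _); congr (val (p _)).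
by apply: val_inj; rewrite /= inordK.
Qed.

Lemma perm_word1 : letters (perm_word 1) = iota 0 3.
Proof. by rewrite letters_perm_word /= !perm1 !inordK. Qed.

(** Permutations compose from left to right: [q * p] applies [q] first. *)
Lemma rename_perm_word (p q : 'S_3) :
  eval (fun i => letter (val (p (inord i)))) (perm_word q) = perm_word (q * p).
Proof.
apply: letters_inj; rewrite (eval_rename (fun i => val (p (inord i)))).
by rewrite !letters_perm_word /= !permM !inord_val.
Qed.

Definition triple (u v : word) : Prop := [/\ uniq u, size u = 3 & perm_eq u v].

Section TripleGroup.

Variables (R : word -> word -> Prop) (Rfic : fic R).

Definition triple_set : {set 'S_3} :=
  [set p | `[< R (perm_word 1) (perm_word p) >]].

Lemma triple_setP p :
  reflect (R (perm_word 1) (perm_word p)) (p \in triple_set).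
Proof. by rewrite inE; apply: asboolP. Qed.

Lemma triple_group_set : group_set triple_set.
Proof.
apply/group_setP; split=> [|p q /triple_setP Rp /triple_setP Rq].
  exact/triple_setP/(fic_refl Rfic).
(* Renaming by [q] turns the relation for [p] into one between the words of [q] and of [p * q]. *)
apply/triple_setP/(fic_trans Rfic Rq).
move/(fic_eval Rfic (fun i => letter (val (q (inord i))))): Rp.
by rewrite !rename_perm_word mul1g.
Qed.

Canonical triple_group := Group triple_group_set.

End TripleGroup.

(** The permutation depends on [u] and [v] only, so that several congruences can be compared through
    their groups. Renaming by [f] carries the words of 1 and [p] to [u] and [v]; renaming by [g]
    carries them back. *)
Lemma triple_perm u v : triple u v -> exists2 p : 'S_3,
  forall R, fic R -> R u v <-> p \in triple_set R & (p = 1 -> u = v).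
Proof.
case=> uu su uv; pose f i := nth 0 u i; pose g i := index i u.
have fu : letters u = map f (iota 0 3).
  by apply: (@eq_from_nth _ 0) => [|k]; rewrite ?size_map// su => ?;
     rewrite (nth_map 0)// nth_iota.
have /tuple_permP[p vp] : perm_eq v (map_tuple f (iota_tuple 3 0)).
  by rewrite perm_sym; change (perm_eq (map f (iota 0 3)) v); rewrite -fu.
have {}vp : letters v = map f (perm_word p).
  rewrite vp letters_perm_word /= (eq_map (g := fun i => f (val (p i)))).
    rewrite !enum_ordSl enum_ord0 /=; congr [:: _; _; _].
    - by congr (f (val (p _))); apply: val_inj; rewrite /= inordK.
    - by congr (f (val (p _))); apply: val_inj; rewrite /= inordK.
    - by congr (f (val (p _))); apply: val_inj; rewrite /= inordK.
  by move=> i /=; rewrite tnth_map (tnth_nth 0) nth_iota.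
have gf i : i < 3 -> g (f i) = i by move=> ?; rewrite /g index_uniq// su.
have uE : u = eval (fun i => letter (f i)) (perm_word 1).
  by apply: letters_inj; rewrite eval_rename perm_word1.
have vE : v = eval (fun i => letter (f i)) (perm_word p).
  by apply: letters_inj; rewrite eval_rename.
have back q : eval (fun i => letter (g i))
    (eval (fun i => letter (f i)) (perm_word q)) = perm_word q.
  apply: letters_inj; rewrite !eval_rename -map_comp map_id_in// => i.
  by rewrite letters_perm_word => /mapP[j _ ->]; exact: (gf _ (ltn_ord _)).
exists p => [R Rfic|p1]; last by rewrite uE vE p1.
split=> [/(fic_eval Rfic (fun i => letter (g i)))|/triple_setP].
  by rewrite uE vE !back => ?; apply/triple_setP.
by move/(fic_eval Rfic (fun i => letter (f i))); rewrite -uE -vE.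
Qed.

(** The order 6 is the product of the three indices along 1, [H], [K], S_3; three factors of at
    least 2 would give at least 8. *)
Lemma S3_chain (H K : {group 'S_3}) : H \subset K ->
  [\/ H :=: 1, K :=: H | K :=: [set: 'S_3]%SET].
Proof.
move=> HK; have := LagrangeI K K; have KT := finset.subsetT K.
have := Lagrange HK; have := Lagrange KT.
rewrite finset.cardsT card_Sn => KE HE _.
have : [|| #|H| == 1%N, #|K : H| == 1%N | #|[set: 'S_3]%SET : K| == 1%N].
  move: KE; rewrite -HE; move: #|H| #|K : H| #|_ : K| => a b c.
  case: a b c => [|[|a]] [|[|b]] [|[|c]] //=; rewrite ?muln0// => abc.
  have := leq_mul (leq_mul (isT : 2 <= a.+2) (isT : 2 <= b.+2))
    (isT : 2 <= c.+2).
  by rewrite abc.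
case/or3P => /eqP c1.
- by constructor 1; apply: card1_trivg.
- by constructor 2; apply/eqP; rewrite finset.eqEsubset HK andbT -indexg_eq1 c1.
- constructor 3; apply/eqP.
  by rewrite finset.eqEsubset finset.subsetT -indexg_eq1 c1.
Qed.

Lemma size_subst (f : nat -> word) s :
  size s <= size (flatten [seq letters (f i) | i <- s]).
Proof. by elim: s => //= i s IH; rewrite size_cat /=; lia. Qed.

(** Forward, the models of one common identity form a variety above [V] and [W]; backward, every
    identity of an upper bound is a common one. *)
Lemma join_eqsP (V W : SEM) S : SEM_join V W S <->
  (forall u v, eqs V u v -> eqs W u v -> satisfies S (u ≈ v)).
Proof.
split=> [VWS u v Vuv Wuv|H X VX WX].
  apply: (VWS (defined_by [:: u ≈ v])) => [T VT|T WT|]; last exact: mem_head.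
    by move=> e /=; rewrite inE => /eqP->; apply: Vuv.
  by move=> e /=; rewrite inE => /eqP->; apply: Wuv.
have [F XF] := variety_equational X; rewrite XF => -[u v] Fuv.
apply: H => T.
  by move/VX; rewrite XF; apply.
by move/WX; rewrite XF; apply.
Qed.

(** The modular law for subgroups of S_3, in a form suited to chains: on triples [Q] absorbs [nu]-
    and [beta]-steps. By [S3_chain] there are three cases. If [beta] is trivial on triples, [Q] is
    [nu]; if [alpha] and [beta] agree there, [Q] is the total relation; if [alpha] relates all
    triples, [nu] implies [theta] there and [Q] is [theta]. *)
Lemma triple_modular (nu beta alpha theta : word -> word -> Prop) :
  fic nu -> fic beta -> fic alpha -> fic theta ->
  (forall u v, beta u v -> alpha u v) -> (forall u v, beta u v -> theta u v) ->
  (forall u v, nu u v -> alpha u v -> theta u v) ->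
  exists Q : word -> word -> Prop,
    [/\ forall u v w, Q u v -> Q v w -> Q u w,
        forall u v, triple u v -> nu u v -> Q u v,
        forall u v, triple u v -> beta u v -> Q u v &
        forall u v, triple u v -> Q u v -> alpha u v -> theta u v].
Proof.
move=> Fn Fb Fa Ft ba bt nat.
have /S3_chain : triple_group Fb \subset triple_group Fa.
  by apply/fintype.subsetP => p /triple_setP/ba ?; apply/triple_setP.
case=> /= E.
- exists nu; split=> [||u v uv|] //; first by move=> u v w; apply: fic_trans.
    have [p pR p1] := triple_perm uv.
    move=> /(pR _ Fb); rewrite E => /set1P/p1 <-; exact: fic_refl.
  by move=> u v _; apply: nat.
- exists (fun _ _ => True); split=> // u v uv _.
  have [p pR _] := triple_perm uv.
  by move/(pR _ Fa); rewrite E => /(pR _ Fb)/bt.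
- exists theta; split=> // [u v w|u v uv nuv|u v _]; first exact: fic_trans.
    apply: nat => //; have [p pR _] := triple_perm uv.
    by apply/(pR _ Fa); rewrite E finset.in_setT.
  exact: bt.
Qed.

(** * A criterion for modularity by null and linear words *)

Section Modular.

Variables (V : SEM) (null : word -> Prop).
Hypothesis null_eqs : forall u v, null u -> null v -> eqs V u v.
Hypothesis null_eval : forall f u, null u -> null (eval f u).
Hypothesis nonlinear_null : forall u : word, ~~ uniq u -> 3 < size u -> null u.
Hypothesis linear_eqs :
  forall u v : word, uniq u -> 3 < size u -> perm_eq u v -> eqs V u v.
Hypothesis eqs_cases : forall u v, eqs V u v ->
  [\/ u = v, null u /\ null v | [/\ uniq u, 2 < size u & perm_eq u v]].

Section Chain.

Variables (beta alpha theta : word -> word -> Prop).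
Hypotheses (Fb : fic beta) (Fa : fic alpha) (Ft : fic theta).
Hypothesis beta_alpha : forall u v, beta u v -> alpha u v.
Hypothesis beta_theta : forall u v, beta u v -> theta u v.
Hypothesis eqs_theta : forall u v, eqs V u v -> alpha u v -> theta u v.

(** The join of the congruences [eqs V] and [beta]. *)
Inductive chain : word -> word -> Prop :=
| chain_refl u : chain u u
| chain_step v u w : eqs V u v \/ beta u v -> chain v w -> chain u w.

Lemma chain_fic : fic chain.
Proof.
have Fn := eqs_fic V.
have tr u v w : chain u v -> chain v w -> chain u w.
  by elim=> // {}u a b ua _ IH /IH; apply: chain_step.
have cong (h : word -> word) : (forall u v, eqs V u v -> eqs V (h u) (h v)) ->
    (forall u v, beta u v -> beta (h u) (h v)) ->
    forall u v, chain u v -> chain (h u) (h v).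
  move=> h1 h2 u v; elim=> [w|a b c ab _ IH]; first exact: chain_refl.
  by apply: chain_step IH; case: ab => [/h1|/h2]; [left|right].
split=> //.
- exact: chain_refl.
- move=> u v; elim=> [w|a b c ab _ IH]; first exact: chain_refl.
  apply: (tr _ _ _ IH); apply: chain_step (chain_refl _).
  by case: ab => /fic_sym; [left|right]; auto.
- by move=> u w v; apply: tr.
- by move=> w; apply: (cong (mul w)) => u v; apply: fic_mull.
- by move=> w; apply: (cong (mul^~ w)) => u v; apply: fic_mulr.
- by move=> f; apply: (cong (eval f)) => u v; apply: fic_eval.
Qed.

Definition nullable (u : word) : Prop := exists2 r, null r & beta u r.

Lemma nullable_beta u v : beta u v -> nullable v -> nullable u.
Proof. by move=> uv [r nr vr]; exists r => //; apply: fic_trans vr. Qed.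

Lemma nullable_perm (u v : word) :
  uniq u -> perm_eq u v -> nullable u -> nullable v.
Proof.
move=> uu uv [r nr ur]; have [s ->] := rename_perm uu uv.
by eexists; [apply/null_eval/nr|apply: fic_eval].
Qed.

Lemma nullable_step u v : eqs V u v \/ beta u v -> nullable u -> nullable v.
Proof.
case=> [/eqs_cases[->//|[_ nv] _|[uu _ uv]]|/(fic_sym Fb)/nullable_beta//].
  by exists v => //; apply: fic_refl.
exact: nullable_perm.
Qed.

Lemma chain_nullable u v : chain u v -> nullable u -> nullable v.
Proof. by elim=> // {}v {}u w /nullable_step uv _ IH /uv/IH. Qed.

(* Squaring a letter that occurs on one side only makes that side null while
   it fixes the other one. *)
Lemma beta_content (u v : word) i : beta u v -> i \in letters u ->
  i \notin letters v -> 2 < size u -> nullable v.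
Proof.
move=> uv iu iv su.
pose f j := if j == i then letter i * letter i else letter j.
have fv : eval f v = v.
  rewrite -[RHS]eval_letter; apply: letters_inj; rewrite !letters_eval.
  congr flatten; apply/eq_in_map => j jv; rewrite /f.
  by case: eqP jv iv => // -> ->.
exists (eval f u); last by rewrite -[v]fv; apply/(fic_eval Fb)/(fic_sym Fb).
have [s1 [s2 us]] : exists s1 s2, letters u = s1 ++ i :: s2.
  by case/splitPr: iu => s1 s2; exists s1, s2.
have fE : letters (eval f u) =
    flatten [seq letters (f j) | j <- s1] ++ i :: i ::
    flatten [seq letters (f j) | j <- s2].
  have fi : letters (f i) = [:: i; i] by rewrite /f eqxx.
  rewrite letters_eval us map_cat flatten_cat /=; congr (_ ++ _).
  by rewrite -[RHS]/([:: i; i] ++ _) -fi.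
apply: nonlinear_null; rewrite fE.
  by rewrite cat_uniq /= mem_head /= !andbF.
have := size_subst f s1; have := size_subst f s2; move: su.
rewrite us !size_cat /=; lia.
Qed.

(** A letter occurring on one side only makes the other side nullable by [beta_content], and [beta]
    carries this over to [u]. *)
Lemma beta_perm (u v : word) : beta u v -> uniq u -> uniq v -> 2 < size u ->
  2 < size v -> nullable u \/ perm_eq u v.
Proof.
move=> uv uu vv su sv; have vu := fic_sym Fb uv.
case: (boolP (all [in letters v] u)) => [/allP uSv|/allPn[i iu iv]]; last first.
  by left; apply: nullable_beta uv (beta_content uv iu iv su).
case: (boolP (all [in letters u] v)) => [/allP vSu|/allPn[i iv iu]]; last first.
  by left; apply: beta_content vu iv iu sv.
by right; apply: uniq_perm => // i; apply/idP/idP => [/uSv|/vSu].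
Qed.

Lemma chain_theta u v : chain u v -> alpha u v -> theta u v.
Proof.
move=> uv auv.
have [Q [Qtr Qn Qb Qth]] :=
  triple_modular (eqs_fic V) Fb Fa Ft beta_alpha beta_theta eqs_theta.
(* One rearrangement standing for a whole run of steps: in length 3 only [Q] is recorded, while in
   greater length [linear_eqs] recovers [eqs V]. *)
pose linked (w x : word) :=
  [/\ uniq w, 2 < size w, perm_eq w x & size w = 3 -> Q w x].
have : [\/ nullable u, beta u v |
    exists w x, [/\ beta u w, linked w x & beta x v]].
  move: uv; elim=> {u v auv} [u|v u w uv vw IH].
    by constructor 2; apply: fic_refl.
  case: uv => [nuv|uv]; last first.
    case: IH => [nv|vw'|[x [y [vx xy yw]]]].
    - by constructor 1; apply: nullable_beta nv.
    - by constructor 2; apply: fic_trans vw'.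
    - by constructor 3; exists x, y; split=> //; apply: fic_trans vx.
  case: (eqs_cases nuv) => [->//|[nu _]|[uu su uv]].
    by constructor 1; exists u => //; apply: fic_refl.
  have univ : uniq v by rewrite -(perm_uniq uv).
  have sv : 2 < size v by rewrite -(perm_size uv).
  have Quv : size u = 3 -> Q u v by move=> s3; apply: Qn.
  have nvu : nullable v -> nullable u.
    by apply: nullable_perm univ _; rewrite perm_sym.
  case: IH => [/nvu|vw'|[x [y [vx [ux sx xy Qxy] yw]]]]; first by constructor 1.
    by constructor 3; exists u, v; split=> //; apply: fic_refl.
  (* Unless [v] is nullable, the [beta]-step between two rearrangements is itself a rearrangement,
     so all three merge into one. *)
  case: (beta_perm vx univ ux sv sx) => [/nvu|vx']; first by constructor 1.
  constructor 3; exists u, y; split=> //; first exact: fic_refl.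
  split=> //; first exact: perm_trans uv (perm_trans vx' xy).
  move=> s3; have s3v : size v = 3 by rewrite -(perm_size uv).
  have s3x : size x = 3 by rewrite -(perm_size vx').
  by apply: Qtr (Quv s3) (Qtr _ _ _ (Qb _ _ _ vx) (Qxy s3x)).
case=> [nu|/beta_theta//|[w [x [uw [uniw sw wx Qwx] xv]]]].
  (* Both ends are replaced by null words [r] and [r'], which are related by [eqs V] and by [alpha],
     hence by [theta]. *)
  have nv := chain_nullable uv nu.
  case: nu nv => [r nr ur] [r' nr' vr'].
  apply: (fic_trans Ft (beta_theta ur)).
  apply: (fic_trans Ft _ (beta_theta (fic_sym Fb vr'))).
  apply: eqs_theta; first exact: null_eqs.
  apply: (fic_trans Fa (beta_alpha (fic_sym Fb ur))).
  exact: (fic_trans Fa auv (beta_alpha vr')).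
apply: (fic_trans Ft (beta_theta uw)).
apply: (fic_trans Ft _ (beta_theta xv)).
have awx : alpha w x.
  apply: (fic_trans Fa (beta_alpha (fic_sym Fb uw))).
  exact: (fic_trans Fa auv (beta_alpha (fic_sym Fb xv))).
have [s3|s4] := leqP (size w) 3.
  have {sw s3} sw : size w = 3 by lia.
  by apply: Qth => //; auto.
by apply: eqs_theta => //; apply: linear_eqs.
Qed.

End Chain.

(** For the nontrivial inequality, [beta] is the theory of [Z], [alpha] that of [Y], and [theta]
    consists of the identities of a semigroup [S] in the left side of the law. *)
Lemma modular_null : modular V.
Proof.
move=> Y Z /asboolP YZ; apply: le_anti; apply/andP; split; last first.
  rewrite lexI leU2 ?leIl// leUx leIr; exact/asboolP.
apply/asboolP => S [/join_eqsP VYS ZS]; apply/join_eqsP => u v VZuv Yuv.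
have ZFb := eqs_fic Z; have YFa := eqs_fic Y.
have Ft := satisfies_fic S.
apply: (@chain_theta (eqs Z) (eqs Y) _ ZFb YFa Ft) => //.
- by move=> a b ab T /YZ; apply: ab.
- by move=> a b ab; apply: ab.
(* The quotient by [chain] lies in [V] and in [Z], so every identity of their meet is a chain. *)
- apply/(free_modelP (chain_fic ZFb))/VZuv; split.
    have [G VG] := variety_equational V; rewrite VG => -[a b] Gab.
    apply/free_modelP; apply: (chain_step _ (chain_refl _ _)); left=> T.
    by rewrite VG => /(_ _ Gab).
  have [G ZG] := variety_equational Z; rewrite ZG => -[a b] Gab.
  apply/free_modelP; apply: (chain_step _ (chain_refl _ _)); right=> T.
  by rewrite ZG => /(_ _ Gab).
Qed.

End Modular.

(** * Normal forms of words *)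

(** Substitution never shortens a word, so the bound forces empty contexts and one-letter images:
    the substitution is a renaming. *)
Lemma subst_letters (f : nat -> word) (a s b : seq nat) :
  size (a ++ flatten [seq letters (f i) | i <- s] ++ b) <= size s ->
  a ++ flatten [seq letters (f i) | i <- s] ++ b = [seq (f i).1 | i <- s].
Proof.
rewrite (size_cat a) (size_cat _ b) => le_s; have le := size_subst f s.
have /size0nil-> : size a = 0 by lia.
have /size0nil-> : size b = 0 by lia.
have {le_s le} : size (flatten [seq letters (f i) | i <- s]) <= size s by lia.
rewrite cats0 cat0s; elim: s => //= i s IH; rewrite size_cat /= => le_s.
have le := size_subst f s.
by case: (f i).2 le_s => [|j t] /= le_s; [rewrite IH//; lia|lia].
Qed.

Lemma uniq_subst (f : nat -> word) s :
  uniq (flatten [seq letters (f i) | i <- s]) -> uniq s.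
Proof.
elim: s => // i s IH U.
have {U} : uniq (letters (f i) ++ flatten [seq letters (f j) | j <- s]) by [].
rewrite cat_uniq => /and3P[_ dis /IH us]; rewrite /= us.
rewrite andbT; apply: contra dis => is_; apply/hasP; exists (f i).1.
  by apply/flattenP; exists (letters (f i)); [apply: map_f|apply: mem_head].
exact: mem_head.
Qed.

Section SyntacticCongruence.

Variables (T : Type) (k : seq nat -> T).

(* The largest fully invariant congruence contained in the kernel of k. *)
Definition syn (u v : word) : Prop := forall (f : nat -> word) (a b : seq nat),
  k (a ++ letters (eval f u) ++ b) = k (a ++ letters (eval f v) ++ b).

Lemma syn_fic : fic syn.
Proof.
split=> [//|u v uv f a b|v u w uv vw f a b|w u v uv f a b|w u v uv f a b
  |f u v uv g a b].
- by rewrite uv.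
- by rewrite uv vw.
- by rewrite !eval_mul !letters_mul -!catA !(catA a) uv.
- by rewrite !eval_mul !letters_mul -!catA uv.
- by rewrite !eval_eval uv.
Qed.

Lemma syn_key u v : syn u v -> k u = k v.
Proof. by move=> /(_ letter [::] [::]); rewrite !eval_letter /= !cats0. Qed.

(** Results with more than 3 letters are covered by the symmetry of [k]. As [u] already has 3
    letters, all other results come from renamings. *)
Lemma syn_perm (u v : word) :
  (forall s t, perm_eq s t -> 3 < size s -> k s = k t) ->
  2 < size u -> perm_eq u v ->
  (forall g, k (map g u) = k (map g v)) -> syn u v.
Proof.
move=> kperm su uv kuv f a b; rewrite !letters_eval.
have pf := perm_flatten (perm_map (fun i => letters (f i)) uv).
have [s4|s3] := ltnP 3 (size (a ++ flatten [seq letters (f i) | i <- u] ++ b)).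
  by apply: kperm => //; rewrite perm_cat2l perm_cat2r.
have s3v : size (a ++ flatten [seq letters (f i) | i <- v] ++ b) <= 3.
  move: s3; rewrite (size_cat a) (size_cat _ b) (perm_size pf).
  by rewrite (size_cat a) (size_cat _ b).
have eu := subst_letters (leq_trans s3 su).
have sv : 2 < size v by rewrite -(perm_size uv).
have ev := subst_letters (leq_trans s3v sv).
exact: etrans (congr1 k eu) (etrans (kuv _) (congr1 k (esym ev))).
Qed.

(** Substituting into a nonlinear word leaves a repeated letter, which settles long results; results
    of length 3 come from renamings. *)
Lemma syn_null (z : T) (u : word) :
  (forall s, ~~ uniq s -> 3 < size s -> k s = z) ->
  2 < size u -> ~~ uniq u -> (forall g, k (map g u) = z) ->
  forall f a b, k (a ++ letters (eval f u) ++ b) = z.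
Proof.
move=> kz su nu ku f a b; rewrite !letters_eval.
have [s4|s3] := ltnP 3 (size (a ++ flatten [seq letters (f i) | i <- u] ++ b)).
  apply: kz => //; apply: contra nu; rewrite cat_uniq (cat_uniq _ b).
  by case/and3P=> _ _ /and3P[/uniq_subst].
exact: etrans (congr1 k (subst_letters (leq_trans s3 su))) (ku _).
Qed.

Lemma syn_zero (z : T) (u : word) :
  (forall s, ~~ uniq s -> 3 < size s -> k s = z) ->
  2 < size u -> ~~ uniq u -> (forall g, k (map g u) = z) ->
  forall e, e \in zero_identities u -> syn e.1 e.2.
Proof.
move=> kz su nu ku.
have k0 := syn_null kz su nu ku.
have ks (w v : word) f a b : w = u * v \/ w = v * u ->
    k (a ++ letters (eval f w) ++ b) = z.
  case=> ->; rewrite eval_mul letters_mul -catA.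
    exact: k0.
  by rewrite catA k0.
pose t := letter (fresh u).
have us : forall f a b, k (a ++ letters (eval f (u * t)) ++ b) = z.
  by move=> f a b; apply: (ks _ t); left.
move=> e; rewrite !inE => /orP[]/eqP-> f a b; rewrite [RHS](us, k0) //.
by apply: (ks _ t); right.
Qed.

Lemma eqs_key (s : seq identity) u v :
  (forall e, e \in s -> syn e.1 e.2) -> eqs (defined_by s) u v -> k u = k v.
Proof.
move=> sk uv; apply: syn_key.
exact: (eqs_sub syn_fic (V := defined_by s) erefl sk uv).
Qed.

End SyntacticCongruence.

(** * Zeros and permutative products *)

Section Absorbing.

Variable S : semigroupType.

Definition absorbing (z : S) : Prop := forall s, s * z = z /\ z * s = z.

Lemma absorbing_uniq z z' : absorbing z -> absorbing z' -> z = z'.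
Proof. by move=> az az'; rewrite -(az z').2 (az' z).1. Qed.

(** The three adjacent transpositions generate S_4, so products of four factors are symmetric. *)
Definition permutative : Prop := forall a b c d : S,
  [/\ a * b * c * d = b * a * c * d, a * b * c * d = a * c * b * d &
      a * b * c * d = a * b * d * c].

Hypothesis Sperm : permutative.
Variable f : nat -> S.

(** Evaluation of sequences; the default 0 is read on the empty sequence only. *)
Let ev (s : seq nat) : S := eval f (head 0 s, behead s).

Let ev_swap l1 i j l2 : 3 < size (l1 ++ i :: j :: l2) ->
  ev (l1 ++ i :: j :: l2) = ev (l1 ++ j :: i :: l2).
Proof.
(* The pair sits at the start, in the middle or at the end of a window of four factors; in the last
   case all factors before [b] are multiplied into one. *)
case: l1 => [|a l].
  case: l2 => [|c [|d l2]] // _; rewrite /ev /eval /=.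
  by have [-> _ _] := Sperm (f i) (f j) (f c) (f d).
case/lastP: l => [|l b].
  case: l2 => [|d l2] // _; rewrite /ev /eval /=.
  by have [_ -> _] := Sperm (f a) (f i) (f j) (f d).
move=> _; rewrite /ev /eval /= !foldl_cat !foldl_rcons /=.
set p := foldl _ _ l; by have [_ _ ->] := Sperm p (f b) (f i) (f j).
Qed.

Let ev_front l1 i s t : 3 < size (l1 ++ s ++ i :: t) ->
  ev (l1 ++ s ++ i :: t) = ev (l1 ++ i :: s ++ t).
Proof.
elim: s l1 => // j s IH l1 /= sz.
have := IH (rcons l1 j); rewrite !cat_rcons => -> //.
by rewrite ev_swap //; move: sz; rewrite !size_cat /= !size_cat /=; lia.
Qed.

Let ev_perm l s t :
  perm_eq s t -> 3 < size (l ++ s) -> ev (l ++ s) = ev (l ++ t).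
Proof.
elim: s l t => [|i s IH] l t st sz.
  by move: st; rewrite perm_sym => /perm_nilP->.
have it : i \in t by rewrite -(perm_mem st) mem_head.
case/splitPr: it st => t1 t2 st.
rewrite (@ev_front l i t1 t2); last first.
  by move: sz; rewrite (size_cat l) (perm_size st) -size_cat.
rewrite -!cat_rcons; apply: IH; last by rewrite cat_rcons.
by move: st; rewrite perm_sym perm_catC /= perm_cons perm_catC perm_sym.
Qed.

Lemma eval_perm (u v : word) : perm_eq u v -> 3 < size u -> eval f u = eval f v.
Proof.
by move=> uv su; have := @ev_perm [::] _ _ uv su; case: u v {uv su} => ? ? [].
Qed.

(** Permuting brings two equal letters to the front; the first four factors then form a zero, which
    further factors preserve. *)
Lemma eval_nonlinear (u : word) :
  (forall a b c : S, absorbing (a * a * b * c)) ->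
  3 < size u -> ~~ uniq u -> absorbing (eval f u).
Proof.
move=> sq su nu.
have [i [s us]] : exists i s, perm_eq u (i :: i :: s).
  elim: (letters u) nu => //= i s IH; rewrite negb_and negbK.
  case/orP => [/rot_index|/IH[j [t st]]].
    move=> E; exists i, (drop (index i s).+1 s ++ take (index i s) s).
    by rewrite perm_cons -E perm_sym perm_rot.
  exists j, (i :: t); rewrite -[j :: j :: i :: t]/([:: j; j] ++ [:: i] ++ t).
  by rewrite perm_sym perm_catCA perm_cons perm_sym.
rewrite (@eval_perm u (i, i :: s) us su).
move: su; rewrite (perm_size us); case: s {us} => [|b [|c s]] // _.
rewrite /eval /=; have := sq (f i) (f b) (f c).
elim: s (f i * f i * f b * f c) => //= j s IH z az; apply: IH.
by rewrite (az (f j)).2.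
Qed.

End Absorbing.

(* The value None stands for the class of the null words; the size keeps the
   values of n3 apart from those on words of other lengths. *)
Definition key (n3 : nat -> nat -> nat -> option (seq nat))
    (n4 : seq nat -> option (seq nat)) (s : seq nat) : option (nat * seq nat) :=
  omap (pair (size s))
    match s with
    | [:: x; y; z] => n3 x y z
    | [:: _, _, _, _ & _] => n4 s
    | _ => Some s
    end.

Lemma key_size n3 n4 s p : key n3 n4 s = Some p -> p.1 = size s.
Proof.
by rewrite /key; case: (match s with [::] => _ | _ => _ end) => //= t [<-].
Qed.

Lemma key3 n3 n4 x y z : key n3 n4 [:: x; y; z] = omap (pair 3) (n3 x y z).
Proof. by []. Qed.

Lemma omap_pair_inj (A B : Type) (a : A) :
  injective (omap (pair a) : option B -> option (A * B)).
Proof. by move=> [r|] [r'|] //= [->]. Qed.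

(** An invariant of the four theories, whose keys differ in [n3] only. *)
Definition linear_key n3 : seq nat -> option (nat * seq nat) :=
  key n3 (fun s => if uniq s then Some (sort leq s) else None).

(** An invariant of the auxiliary varieties refuting cancellability; [h] will normalise a triple up
    to one transposition. *)
Definition triple_key (h : nat -> nat -> nat -> seq nat) :
    seq nat -> option (nat * seq nat) :=
  key (fun x y z => if uniq [:: x; y; z] then Some (h x y z) else None)
      (fun _ => None).

Lemma linear_key_perm n3 s t :
  perm_eq s t -> 3 < size s -> linear_key n3 s = linear_key n3 t.
Proof.
move=> st; have := perm_size st; have := perm_uniq st.
have /perm_sortP := st; move/(_ leq leq_total leq_trans anti_leq).
case: s t {st} => [|a [|b [|c [|d s]]]] [|a' [|b' [|c' [|d' t]]]] // st us ss _.
by rewrite /linear_key /key us st ss.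
Qed.

Lemma linear_key_nonlinear n3 s :
  ~~ uniq s -> 3 < size s -> linear_key n3 s = None.
Proof.
by case: s => [|a [|b [|c [|d s]]]] // /negPf us _; rewrite /linear_key /key us.
Qed.

Lemma linear_syn_perm n3 (u v : word) : 2 < size u -> perm_eq u v ->
  (forall g, linear_key n3 (map g u) = linear_key n3 (map g v)) ->
  syn (linear_key n3) u v.
Proof. by apply: syn_perm => s t; apply: linear_key_perm. Qed.

Lemma linear_syn_zero n3 (u : word) : 2 < size u -> ~~ uniq u ->
  (forall g, linear_key n3 (map g u) = None) ->
  forall e, e \in zero_identities u -> syn (linear_key n3) e.1 e.2.
Proof. by apply: syn_zero => s; apply: linear_key_nonlinear. Qed.

Lemma triple_key_long h s : 3 < size s -> triple_key h s = None.
Proof. by case: s => [|a [|b [|c [|d s]]]]. Qed.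

(** Null words are those whose values are zeros in all members of [V]; the key [None] implies this.
    Equal keys other than [None] leave only equal words and rearrangements of linear words, as
    [modular_null] demands. *)
Lemma modular_key (V : SEM) n3 :
  (forall u v, eqs V u v -> linear_key n3 u = linear_key n3 v) ->
  (forall S, V S -> permutative S) ->
  (forall S, V S -> forall a b c : S, absorbing (a * a * b * c)) ->
  (forall S, V S -> forall (f : nat -> S) x y z, n3 x y z = None ->
     absorbing (f x * f y * f z)) ->
  (forall x y z x' y' z', n3 x y z = n3 x' y' z' -> n3 x y z ->
     [:: x; y; z] = [:: x'; y'; z'] \/
     uniq [:: x; y; z] && perm_eq [:: x; y; z] [:: x'; y'; z']) ->
  modular V.
Proof.
move=> Vkey Vperm Vsq Vnone Vsome.
pose null (u : word) := forall S : semigroup, V S ->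
  forall f : nat -> S, absorbing (eval f u).
have null_key (u : word) : linear_key n3 u = None -> null u.
  case: u => x [|y [|z [|t s]]] //.
    move=> n S VS f; rewrite /eval /=; apply: Vnone => //.
    by move: n; rewrite /linear_key /key /=; case: (n3 x y z).
  rewrite /linear_key /key; case: ifP => // /negbT us _ S VS f.
  by apply: eval_nonlinear us; [exact: Vperm|exact: Vsq|].
apply: (modular_null (null := null)) => [u v nu nv S VS f|f u nu S VS g
  |u us su|u v us su uv S VS f|u v uv].
- by apply: absorbing_uniq; [apply: nu|apply: nv].
- by rewrite eval_eval; apply: nu.
- by apply: null_key; apply: linear_key_nonlinear.
- by apply: eval_perm => //; apply: Vperm.
have kuv := Vkey _ _ uv; case ku : (linear_key n3 u) => [p|]; last first.
  by constructor 2; split; apply: null_key => //; rewrite -kuv.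
have kv := etrans (esym kuv) ku.
have suv := etrans (esym (key_size ku)) (key_size kv).
have : linear_key n3 v != None by rewrite kv.
move: kuv suv; clear -Vsome.
case: u v => x [|y [|z [|t s]]] [x' [|y' [|z' [|t' s']]]] //.
- by case=> ->; constructor 1.
- by case=> -> ->; constructor 1.
- rewrite /linear_key /key /= => E _ nn.
  have E3 := omap_pair_inj E.
  have : n3 x y z by rewrite E3; case: (n3 x' y' z') nn.
  case/(Vsome _ _ _ _ _ _ E3) => [[-> -> ->]|/andP[us ps]].
    by constructor 1.
  by constructor 3.
rewrite /linear_key /key; case: ifP => [us|_]; case: ifP => [us'|_] //.
move=> [_ E] _ _; constructor 3; split=> //.
by apply/(perm_sortP leq_total leq_trans anti_leq).
Qed.

(** * Failure of cancellability *)

Definition word3 (i j k : nat) : word := (i, [:: j; k]).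

Definition nilpotent_word (u : word) : bool :=
  (2 < size u) && ((3 < size u) || ~~ uniq u).

(** Nilpotent words form an ideal of the free semigroup, so identifying them with each other makes
    them zero; [e0] is left to act on linear triples. *)
Definition nil_variety (e0 : identity) : SEM := Variety (ex_intro _
  [set e | e = e0 \/ nilpotent_word e.1 && nilpotent_word e.2]%classic erefl).

Lemma nil_variety_key h i j k (u v : word) :
  perm_eq (word3 0 1 2) (word3 i j k) ->
  (forall g : nat -> nat, h (g 0%N) (g 1%N) (g 2) = h (g i) (g j) (g k)) ->
  eqs (nil_variety (word3 0 1 2 ≈ word3 i j k)) u v ->
  triple_key h u = triple_key h v.
Proof.
move=> ijk hg uv; apply: syn_key.
apply: (eqs_sub (syn_fic (triple_key h)) (V := nil_variety _) erefl _ uv).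
move=> e [->|].
  apply: syn_perm => //= [s t st s4|g].
    by rewrite !triple_key_long// -(perm_size st).
  rewrite /triple_key /key hg.
  by have := perm_uniq (perm_map g ijk) => /= ->.
have nk (w : word) : nilpotent_word w ->
    forall f a b, triple_key h (a ++ letters (eval f w) ++ b) = None.
  case/andP => sw /orP[s4|nw] f a b.
    apply: triple_key_long; rewrite letters_eval (size_cat a) (size_cat _ b).
    have := size_subst f w; lia.
  apply: syn_null => //; first by move=> s _; apply: triple_key_long.
  move=> g; have := @map_uniq _ _ g w; move: sw nw.
  case: w => x [|y [|z [|t s]]] // _ nw.
  rewrite /triple_key /key; case: ifP => // _.
  by move/(_ isT) => u3'; rewrite u3' in nw.
by case/andP=> /nk k1 /nk k2 f a b; rewrite k1 k2.
Qed.

(** The first hypothesis expresses that two subgroups of S_3 meet trivially, so no two distinct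
    linear triples share both keys. *)
Lemma linear_triple_key n3 h (u v : word) :
  (forall x y z x' y' z', uniq [:: x; y; z] -> uniq [:: x'; y'; z'] ->
     n3 x y z = n3 x' y' z' -> h x y z = h x' y' z' ->
     [:: x; y; z] = [:: x'; y'; z']) ->
  linear_key n3 u = linear_key n3 v -> triple_key h u = triple_key h v ->
  u = v \/ nilpotent_word u && nilpotent_word v.
Proof.
move=> sep kuv huv.
have null_key (w : word) : (triple_key h w == None) = nilpotent_word w.
  case: w => x [|y [|z [|t s]]] //.
  by rewrite /triple_key /key /nilpotent_word; case: ifP => [us|/negbT us];
    rewrite /= ?us // -/(uniq [:: x; y; z]) us.
case hu : (triple_key h u) => [p|]; last first.
  by right; rewrite -!null_key -huv hu.
left; have suv := etrans (esym (key_size hu)) (key_size (etrans (esym huv) hu)).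
have {hu} : triple_key h u != None by rewrite hu.
move: kuv huv suv.
case: u v => x [|y [|z [|t s]]] [x' [|y' [|z' [|t' s']]]] //.
- by case=> ->.
- by case=> -> ->.
move=> E E' _ nn; have us : uniq [:: x; y; z].
  by move: nn; rewrite null_key => /negPn.
have us' : uniq [:: x'; y'; z'] by move: nn; rewrite E' null_key => /negPn.
move: E'; rewrite /triple_key (key3 _ _ x) (key3 _ _ x') us us' => -[hh].
move: E; rewrite /linear_key (key3 _ _ x) (key3 _ _ x') => nn3.
by have [-> -> ->] := sep _ _ _ _ _ _ us us' (omap_pair_inj nn3) hh.
Qed.

(** The witnesses are [nil_variety e1] and [nil_variety e2]. Their joins with [V] agree, since
    identities shared with [V] are trivial or between nilpotent words; their meets agree, since [e1]
    and [e2] are equivalent in [V]. They differ because [h2] separates the sides of [e1]. *)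
Lemma not_cancellable (V : SEM) n3
    (h1 h2 : nat -> nat -> nat -> seq nat) i1 j1 k1 i2 j2 k2 :
  let e1 := word3 0 1 2 ≈ (word3 i1 j1 k1) in
  let e2 := word3 0 1 2 ≈ (word3 i2 j2 k2) in
  (forall u v, eqs V u v -> linear_key n3 u = linear_key n3 v) ->
  (forall S, V S -> satisfies S e1 <-> satisfies S e2) ->
  perm_eq (word3 0 1 2) (word3 i1 j1 k1) ->
  perm_eq (word3 0 1 2) (word3 i2 j2 k2) ->
  (forall g : nat -> nat, h1 (g 0%N) (g 1%N) (g 2) = h1 (g i1) (g j1) (g k1)) ->
  (forall g : nat -> nat, h2 (g 0%N) (g 1%N) (g 2) = h2 (g i2) (g j2) (g k2)) ->
  (forall x y z x' y' z', uniq [:: x; y; z] -> uniq [:: x'; y'; z'] ->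
     n3 x y z = n3 x' y' z' ->
     h1 x y z = h1 x' y' z' \/ h2 x y z = h2 x' y' z' ->
     [:: x; y; z] = [:: x'; y'; z']) ->
  h2 0%N 1%N 2 <> h2 i1 j1 k1 ->
  ~ cancellable V.
Proof.
move=> e1 e2 Vkey V12 p1 p2 H1 H2 sep h12 cV.
have join_le i j k (e := word3 0 1 2 ≈ word3 i j k)
    (h : nat -> nat -> nat -> seq nat) e' :
    perm_eq (word3 0 1 2) (word3 i j k) ->
    (forall g : nat -> nat, h (g 0%N) (g 1%N) (g 2) = h (g i) (g j) (g k)) ->
    (forall x y z x' y' z', uniq [:: x; y; z] -> uniq [:: x'; y'; z'] ->
       n3 x y z = n3 x' y' z' -> h x y z = h x' y' z' ->
       [:: x; y; z] = [:: x'; y'; z']) ->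
    (V `|` nil_variety e' <= V `|` nil_variety e)%O.
  move=> p H s; apply/asboolP => S /join_eqsP VS.
  apply/join_eqsP => u v Vuv Yuv.
  apply: VS => // T YT.
  have huv := nil_variety_key p H Yuv.
  have [->//|uv] := linear_triple_key s (Vkey _ _ Vuv) huv.
  by apply: YT; right.
have meet_le e e' : (forall S, V S -> satisfies S e -> satisfies S e') ->
    (V `&` nil_variety e <= V `&` nil_variety e')%O.
  move=> ee'; apply/asboolP => S [VS YS]; split=> // x [->|nx].
    by apply: ee' => //; apply: YS; left.
  by apply: YS; right.
have E : nil_variety e1 = nil_variety e2; first apply: cV.
- apply: le_anti; apply/andP; split.
    apply: (join_le _ _ _ h2) => // x y z x' y' z' u1 u2 nn hh.
    by apply: sep => //; right.
  apply: (join_le _ _ _ h1) => // x y z x' y' z' u1 u2 nn hh.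
  by apply: sep => //; left.
- by apply: le_anti; apply/andP; split; apply: meet_le => S VS /(V12 S VS).
have : eqs (nil_variety e2) (word3 0 1 2) (word3 i1 j1 k1).
  by rewrite -E => S; apply; left.
move/(nil_variety_key p2 H2); rewrite /triple_key /key /=.
have /= <- := perm_uniq p1; by case.
Qed.

(** * The four varieties *)

Section ThreeLetterIdentities.

Variable S : semigroupType.
Implicit Types a b c d : S.

(** Applying the identity to three of the four factors, or to three factors one of which is a
    product of two, yields permutations that generate S_4; each [r] is named after the positions it
    moves. The next three lemmas proceed alike. *)
Lemma permutative_reverse :
  (forall a b c, a * b * c = c * b * a) -> permutative S.
Proof.
move=> H.
have r13 a b c d : a * b * c * d = c * b * a * d by rewrite (H a).
have r24 a b c d : a * b * c * d = a * d * c * b.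
  by have := congr1 (mul a) (H b c d); rewrite !mulgA.
have r14 a b c d : a * b * c * d = d * b * c * a.
  by have := H a (b * c) d; rewrite !mulgA.
have r12 a b c d : a * b * c * d = b * a * c * d.
  exact: etrans (r14 _ _ _ _) (etrans (r24 _ _ _ _) (r14 _ _ _ _)).
move=> a b c d; split=> //.
  exact: etrans (r13 _ _ _ _) (etrans (r12 _ _ _ _) (r13 _ _ _ _)).
exact: etrans (r13 _ _ _ _) (etrans (r14 _ _ _ _) (r13 _ _ _ _)).
Qed.

Lemma permutative_rotate :
  (forall a b c, a * b * c = b * c * a) -> permutative S.
Proof.
move=> H.
have r123 a b c d : a * b * c * d = b * c * a * d by rewrite (H a).
have r234 a b c d : a * b * c * d = a * c * d * b.
  by have := congr1 (mul a) (H b c d); rewrite !mulgA.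
have r1234 a b c d : a * b * c * d = b * c * d * a.
  by have := H a b (c * d); rewrite !mulgA.
have r12 a b c d : a * b * c * d = b * a * c * d.
  exact: etrans (r1234 _ _ _ _) (etrans (r234 _ _ _ _) (r234 _ _ _ _)).
have r23 a b c d : a * b * c * d = a * c * b * d.
  exact: etrans (r123 _ _ _ _) (etrans (r123 _ _ _ _) (r12 _ _ _ _)).
move=> a b c d; split=> //.
exact: etrans (r234 _ _ _ _) (etrans (r234 _ _ _ _) (r23 _ _ _ _)).
Qed.

Lemma permutative_swap12 :
  (forall a b c, a * b * c = b * a * c) ->
  (forall a b c d, a * b * c * d = a * c * d * b) -> permutative S.
Proof.
move=> H r234.
have r12 a b c d : a * b * c * d = b * a * c * d by rewrite (H a).
have r123 a b c d : a * b * c * d = b * c * a * d.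
  by have := H a (b * c) d; rewrite !mulgA.
have r23 a b c d : a * b * c * d = a * c * b * d.
  apply: etrans (r123 a b c d) (etrans (r12 _ _ _ _) (esym (r123 a c b d))).
move=> a b c d; split=> //.
exact: etrans (r234 _ _ _ _) (etrans (r234 _ _ _ _) (r23 _ _ _ _)).
Qed.

Lemma permutative_swap23 :
  (forall a b c, a * b * c = a * c * b) ->
  (forall a b c d, a * b * c * d = b * c * a * d) -> permutative S.
Proof.
move=> H r123.
have r34 a b c d : a * b * c * d = a * b * d * c by exact: H.
have r234 a b c d : a * b * c * d = a * d * b * c.
  by have := H a (b * c) d; rewrite !mulgA.
have r23 a b c d : a * b * c * d = a * c * b * d.
  exact: etrans (r234 a b c d) (etrans (r34 _ _ _ _) (esym (r234 a c b d))).
move=> a b c d; split=> //.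
exact: etrans (r123 _ _ _ _) (r23 _ _ _ _).
Qed.

Lemma zero_absorbing (a b : S) (u : word) :
  u = letter 0 * letter 0 * letter 1 \/ u = letter 0 * letter 1 * letter 1 ->
  (forall e, e \in zero_identities u -> satisfies S e) ->
  absorbing (eval (fun i => if i is 0 then a else b) u).
Proof.
(* [f] extends the valuation by giving the fresh letter 2 the arbitrary value [s]. *)
move=> uE Z s; pose f i := if i is 0 then a else if i is 1 then b else s.
have fu : eval (fun i => if i is 0 then a else b) u = eval f u.
  by case: uE => ->.
have fs : fresh u = 2 by case: uE => ->.
have us := Z _ (mem_head _ _) f.
have : (u * letter (fresh u) ≈ u) \in zero_identities u.
  by rewrite !inE eqxx orbT.
move/Z/(_ f); move: us; rewrite /= !eval_mul fu fs => su us.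
by split; [rewrite [LHS]su|].
Qed.

End ThreeLetterIdentities.

(** * Normal forms of words of length three *)

Definition key12 (x y z : nat) := [:: minn x y; maxn x y; z].
Definition key13 (x y z : nat) := [:: minn x z; y; maxn x z].
Definition key23 (x y z : nat) := [:: x; minn y z; maxn y z].

(** For distinct letters, the rotation that starts with the least one. *)
Definition cyclic_key (x y z : nat) :=
  if (x < y) && (x < z) then [:: x; y; z]
  else if (y < z) && (y < x) then [:: y; z; x] else [:: z; x; y].

Lemma cyclic_key_perm x y z : perm_eq (cyclic_key x y z) [:: x; y; z].
Proof.
rewrite /cyclic_key; case: ifP => // _; case: ifP => _.
  by rewrite -[[:: y; z; x]]/(rot 1 [:: x; y; z]) perm_rot.
by rewrite -[[:: z; x; y]]/(rot 2 [:: x; y; z]) perm_rot.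
Qed.

Lemma cyclic_key_rot x y z : uniq [:: x; y; z] ->
  cyclic_key x y z = cyclic_key y z x.
Proof.
rewrite /cyclic_key /= !inE => u.
by do 2![case: ifP => ?]; do ?[case: ifP => ?]; rewrite //; lia.
Qed.

(** Null are the words xxy and yxx, while xyx with distinct letters is alone in its class. Likewise
    xxy survives in [swap12_nf] and xyy in [swap23_nf]; in [rotate_nf] all nonlinear words are
    null. *)
Definition reverse_nf x y z := if (x == y) || (y == z)
  then None else Some (key13 x y z).
Definition rotate_nf x y z :=
  if uniq [:: x; y; z] then Some (cyclic_key x y z) else None.
Definition swap12_nf x y z := if (x == z) || (y == z)
  then None else Some (key12 x y z).
Definition swap23_nf x y z := if (x == y) || (x == z)
  then None else Some (key23 x y z).

Lemma perm3P (x y z x' y' z' : nat) :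
  [\/ [:: x'; y'; z'] = [:: x; z; y], [:: x'; y'; z'] = [:: y; x; z] |
      [:: x'; y'; z'] = [:: z; y; x]] ->
  perm_eq [:: x; y; z] [:: x'; y'; z'].
Proof.
by case=> ->; apply/allP => i _ /=; apply/eqP; lia.
Qed.

Lemma seq3_eq (x y z x' y' z' : nat) :
  x = x' /\ y = y' /\ z = z' -> [:: x; y; z] = [:: x'; y'; z'].
Proof. by case=> [-> [-> ->]]. Qed.

(** Reversal and an adjacent transposition generate subgroups that meet trivially, so the two orbits
    of a linear triple determine it. *)
Lemma reverse_nf_separated x y z x' y' z' :
  uniq [:: x; y; z] -> uniq [:: x'; y'; z'] ->
  reverse_nf x y z = reverse_nf x' y' z' ->
  key12 x y z = key12 x' y' z' \/ key23 x y z = key23 x' y' z' ->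
  [:: x; y; z] = [:: x'; y'; z'].
Proof.
rewrite /reverse_nf /= !inE => u u'; do 2!(case: ifP; first lia).
move=> _ _ [e1 e2 e3] H.
apply: seq3_eq; case: H => -[h1 h2 h3]; lia.
Qed.

Lemma rotate_nf_separated x y z x' y' z' :
  uniq [:: x; y; z] -> uniq [:: x'; y'; z'] ->
  rotate_nf x y z = rotate_nf x' y' z' ->
  key12 x y z = key12 x' y' z' \/ key23 x y z = key23 x' y' z' ->
  [:: x; y; z] = [:: x'; y'; z'].
Proof.
rewrite /rotate_nf => u u'; rewrite u u' => -[E] H; apply: seq3_eq.
have {H} H : z = z' /\ minn x y = minn x' y' \/ x = x' /\ minn y z = minn y' z'.
  by case: H => -[h1 h2 h3]; [left|right].
move: E u u'; rewrite /cyclic_key /= !inE.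
by do ?[case: ifP => _] => -[e1 e2 e3]; lia.
Qed.

Lemma swap12_nf_separated x y z x' y' z' :
  uniq [:: x; y; z] -> uniq [:: x'; y'; z'] ->
  swap12_nf x y z = swap12_nf x' y' z' ->
  key13 x y z = key13 x' y' z' \/ key23 x y z = key23 x' y' z' ->
  [:: x; y; z] = [:: x'; y'; z'].
Proof.
rewrite /swap12_nf /= !inE => u u'; do 2!(case: ifP; first lia).
move=> _ _ [e1 e2 e3] H.
apply: seq3_eq; case: H => -[h1 h2 h3]; lia.
Qed.

Lemma swap23_nf_separated x y z x' y' z' :
  uniq [:: x; y; z] -> uniq [:: x'; y'; z'] ->
  swap23_nf x y z = swap23_nf x' y' z' ->
  key12 x y z = key12 x' y' z' \/ key13 x y z = key13 x' y' z' ->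
  [:: x; y; z] = [:: x'; y'; z'].
Proof.
rewrite /swap23_nf /= !inE => u u'; do 2!(case: ifP; first lia).
move=> _ _ [e1 e2 e3] H.
apply: seq3_eq; case: H => -[h1 h2 h3]; lia.
Qed.

Lemma reverse_nf_perm x y z x' y' z' :
  reverse_nf x y z = reverse_nf x' y' z' -> reverse_nf x y z ->
  [:: x; y; z] = [:: x'; y'; z'] \/
  uniq [:: x; y; z] && perm_eq [:: x; y; z] [:: x'; y'; z'].
Proof.
rewrite /reverse_nf; case: ifP => // n; case: ifP => // n' [e1 e2 e3] _.
(* If [x = z] the word is its own reversal; if [x = x'] the keys force equality; otherwise the
   second word is the reversal of the first. *)
have [xz|xz] := eqVneq x z; first by left; apply: seq3_eq; lia.
have [xx'|xx'] := eqVneq x x'; first by left; apply: seq3_eq; lia.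
right; apply/andP; split; first by rewrite /= !inE; lia.
by apply: perm3P; constructor 3; apply: seq3_eq; lia.
Qed.

Lemma rotate_nf_perm x y z x' y' z' :
  rotate_nf x y z = rotate_nf x' y' z' -> rotate_nf x y z ->
  [:: x; y; z] = [:: x'; y'; z'] \/
  uniq [:: x; y; z] && perm_eq [:: x; y; z] [:: x'; y'; z'].
Proof.
rewrite /rotate_nf; case: ifP => // u; case: ifP => // u' [E] _; right.
by rewrite andTb -(permPl (cyclic_key_perm x y z)) E cyclic_key_perm.
Qed.

Lemma swap12_nf_perm x y z x' y' z' :
  swap12_nf x y z = swap12_nf x' y' z' -> swap12_nf x y z ->
  [:: x; y; z] = [:: x'; y'; z'] \/
  uniq [:: x; y; z] && perm_eq [:: x; y; z] [:: x'; y'; z'].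
Proof.
rewrite /swap12_nf; case: ifP => // n; case: ifP => // n' [e1 e2 e3] _.
have [xz|xz] := eqVneq x y; first by left; apply: seq3_eq; lia.
have [xx'|xx'] := eqVneq x x'; first by left; apply: seq3_eq; lia.
right; apply/andP; split; first by rewrite /= !inE; lia.
by apply: perm3P; constructor 2; apply: seq3_eq; lia.
Qed.

Lemma swap23_nf_perm x y z x' y' z' :
  swap23_nf x y z = swap23_nf x' y' z' -> swap23_nf x y z ->
  [:: x; y; z] = [:: x'; y'; z'] \/
  uniq [:: x; y; z] && perm_eq [:: x; y; z] [:: x'; y'; z'].
Proof.
rewrite /swap23_nf; case: ifP => // n; case: ifP => // n' [e1 e2 e3] _.
have [xz|xz] := eqVneq y z; first by left; apply: seq3_eq; lia.
have [xx'|xx'] := eqVneq y y'; first by left; apply: seq3_eq; lia.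
right; apply/andP; split; first by rewrite /= !inE; lia.
by apply: perm3P; constructor 1; apply: seq3_eq; lia.
Qed.

Section Varieties.

Let x := letter 0.
Let y := letter 1.
Let z := letter 2.
Let t := letter 3.

Lemma reverse_variety (V : SEM) :
  V = defined_by [:: x * y * z ≈ z * y * x & zero_identities (x * x * y)] ->
  modular V /\ ~ cancellable V.
Proof.
move=> VE.
have H (S : semigroup) : V S -> forall a b c : S, a * b * c = c * b * a.
  rewrite VE => VS a b c.
  (* The valuation sends the letters 0, 1, 2 to [a], [b], [c] and all others to the default [a]. *)
  exact: (VS _ (mem_head _ _) (nth a [:: a; b; c])).
have Z (S : semigroup) : V S -> forall a b : S, absorbing (a * a * b).
  rewrite VE => VS a b.
  apply: (zero_absorbing a b (u := x * x * y)); first by left.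
  by move=> e eZ; apply: VS; rewrite /= inE eZ orbT.
have K u v : eqs V u v -> linear_key reverse_nf u = linear_key reverse_nf v.
  rewrite VE; apply: eqs_key => e; rewrite inE => /predU1P[->|].
    apply: linear_syn_perm => //= g.
    rewrite /linear_key !key3 /reverse_nf /key13 minnC maxnC orbC.
    by rewrite (eq_sym (g 0%N)) (eq_sym (g 2)).
  apply: linear_syn_zero => //= g.
  by rewrite /linear_key !key3 /reverse_nf eqxx.
split.
  apply: (modular_key K) => [S VS|S VS a b c|S VS f i j k|i j k i' j' k'].
  - exact/permutative_reverse/H.
  - by rewrite (Z S VS _ _ _).2; apply: Z.
  - rewrite /reverse_nf; case: eqVneq => [-> _|_ /=]; first exact: Z.
    by case: eqVneq => // -> _; rewrite (H S VS); apply: Z.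
  - exact: reverse_nf_perm.
(* Here G is generated by (1 3), which conjugates (1 2) into (2 3); these two define the
   witnesses. *)
apply: (@not_cancellable V reverse_nf key12 key23 1 0 2 0 2 1 K) => //.
- move=> S VS; have h := H S VS; split=> E f.
    have e a b c : a * b * c = b * a * c := E (nth a [:: a; b; c]).
    by rewrite [LHS]h [RHS]h; apply: e.
  have e a b c : a * b * c = a * c * b := E (nth a [:: a; b; c]).
  by rewrite [LHS]h [RHS]h; apply: e.
- by move=> g; rewrite /key12 minnC maxnC.
- by move=> g; rewrite /key23 minnC maxnC.
- exact: reverse_nf_separated.
Qed.

Lemma rotate_variety (V : SEM) :
  V = defined_by [:: x * y * z ≈ y * z * x & zero_identities (x * x * y)] ->
  modular V /\ ~ cancellable V.
Proof.
move=> VE.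
have H (S : semigroup) : V S -> forall a b c : S, a * b * c = b * c * a.
  rewrite VE => VS a b c.
  exact: (VS _ (mem_head _ _) (nth a [:: a; b; c])).
have Z (S : semigroup) : V S -> forall a b : S, absorbing (a * a * b).
  rewrite VE => VS a b.
  apply: (zero_absorbing a b (u := x * x * y)); first by left.
  by move=> e eZ; apply: VS; rewrite /= inE eZ orbT.
have K u v : eqs V u v -> linear_key rotate_nf u = linear_key rotate_nf v.
  rewrite VE; apply: eqs_key => e; rewrite inE => /predU1P[->|].
    apply: linear_syn_perm => //= g.
    rewrite /linear_key !key3 /rotate_nf -(rot_uniq 1 [:: g 0%N; g 1%N; g 2]).
    by case: ifP => // u3; rewrite cyclic_key_rot // -(rot_uniq 1).
  apply: linear_syn_zero => //= g.
  by rewrite /linear_key !key3 /rotate_nf /= mem_head.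
split.
  apply: (modular_key K) => [S VS|S VS a b c|S VS f i j k|i j k i' j' k'].
  - exact/permutative_rotate/H.
  - by rewrite (Z S VS _ _ _).2; apply: Z.
  - rewrite /rotate_nf /= !inE andbT negb_or; have h := H S VS.
    case: eqVneq => [-> _|_ /=]; first exact: Z.
    case: eqVneq => [->|_ /=]; first by rewrite -h => _; apply: Z.
    by case: eqVneq => // -> _; rewrite h; apply: Z.
  - exact: rotate_nf_perm.
(* Here G is A_3, which generates S_3 with any transposition, so (1 2) and (2 3) serve. *)
apply: (@not_cancellable V rotate_nf key12 key23 1 0 2 0 2 1 K) => //.
- move=> S VS; have h := H S VS; split=> E f.
    have e a b c : a * b * c = b * a * c := E (nth a [:: a; b; c]).
    by rewrite [LHS]h [LHS]e [RHS]h.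
  have e a b c : a * b * c = a * c * b := E (nth a [:: a; b; c]).
  by rewrite [LHS]e [LHS]h [LHS]h.
- by move=> g; rewrite /key12 minnC maxnC.
- by move=> g; rewrite /key23 minnC maxnC.
- exact: rotate_nf_separated.
Qed.

Lemma swap12_variety (V : SEM) :
  V = defined_by [:: x * y * z ≈ y * x * z, x * y * z * t ≈ x * z * t * y
                   & zero_identities (x * y * y)] ->
  modular V /\ ~ cancellable V.
Proof.
move=> VE.
have H (S : semigroup) : V S -> forall a b c : S, a * b * c = b * a * c.
  rewrite VE => VS a b c.
  exact: (VS _ (mem_head _ _) (nth a [:: a; b; c])).
have H4 (S : semigroup) : V S ->
    forall a b c d : S, a * b * c * d = a * c * d * b.
  rewrite VE => VS a b c d.
  have e : satisfies S (x * y * z * t ≈ x * z * t * y).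
    by apply: VS; rewrite /= !inE eqxx orbT.
  exact: (e (nth a [:: a; b; c; d])).
have Z (S : semigroup) : V S -> forall a b : S, absorbing (a * b * b).
  rewrite VE => VS a b.
  apply: (zero_absorbing a b (u := x * y * y)); first by right.
  by move=> e eZ; apply: VS; rewrite /= 2!inE eZ !orbT.
have K u v : eqs V u v -> linear_key swap12_nf u = linear_key swap12_nf v.
  rewrite VE; apply: eqs_key => e; rewrite inE => /predU1P[->|].
    apply: linear_syn_perm => //= g.
    by rewrite /linear_key !key3 /swap12_nf /key12 minnC maxnC orbC.
  rewrite inE => /predU1P[->|].
    apply: linear_syn_perm => // g.
    by apply: linear_key_perm; first exact: perm_map.
  apply: linear_syn_zero => //= g.
  by rewrite /linear_key !key3 /swap12_nf eqxx orbT.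
split.
  apply: (modular_key K) => [S VS|S VS a b c|S VS f i j k|i j k i' j' k'].
  - exact: permutative_swap12 (H S VS) (H4 S VS).
  (* aabc = abac = baac, and baa is already a zero. *)
  - have [_ e _] := permutative_swap12 (H S VS) (H4 S VS) a a b c.
    have [e' _ _] := permutative_swap12 (H S VS) (H4 S VS) a b a c.
    by rewrite e e' (Z S VS _ _ _).2; apply: Z.
  - rewrite /swap12_nf; case: eqVneq => [-> _|_ /=]; last first.
      by case: eqVneq => // -> _; apply: Z.
    by rewrite (H S VS); apply: Z.
  - exact: swap12_nf_perm.
(* Here G is generated by (1 2), which conjugates (1 3) into (2 3). *)
apply: (@not_cancellable V swap12_nf key13 key23 2 1 0 0 2 1 K) => //.
- move=> S VS; have h := H S VS; split=> E f.
    have e a b c : a * b * c = c * b * a := E (nth a [:: a; b; c]).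
    by rewrite [LHS]h [LHS]e [LHS]h.
  have e a b c : a * b * c = a * c * b := E (nth a [:: a; b; c]).
  by rewrite [LHS]e [LHS]h [LHS]e.
- by move=> g; rewrite /key13 minnC maxnC.
- by move=> g; rewrite /key23 minnC maxnC.
- exact: swap12_nf_separated.
Qed.

Lemma swap23_variety (V : SEM) :
  V = defined_by [:: x * y * z ≈ x * z * y, x * y * z * t ≈ y * z * x * t
                   & zero_identities (x * x * y)] ->
  modular V /\ ~ cancellable V.
Proof.
move=> VE.
have H (S : semigroup) : V S -> forall a b c : S, a * b * c = a * c * b.
  rewrite VE => VS a b c.
  exact: (VS _ (mem_head _ _) (nth a [:: a; b; c])).
have H4 (S : semigroup) : V S ->
    forall a b c d : S, a * b * c * d = b * c * a * d.
  rewrite VE => VS a b c d.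
  have e : satisfies S (x * y * z * t ≈ y * z * x * t).
    by apply: VS; rewrite /= !inE eqxx orbT.
  exact: (e (nth a [:: a; b; c; d])).
have Z (S : semigroup) : V S -> forall a b : S, absorbing (a * a * b).
  rewrite VE => VS a b.
  apply: (zero_absorbing a b (u := x * x * y)); first by left.
  by move=> e eZ; apply: VS; rewrite /= 2!inE eZ !orbT.
have K u v : eqs V u v -> linear_key swap23_nf u = linear_key swap23_nf v.
  rewrite VE; apply: eqs_key => e; rewrite inE => /predU1P[->|].
    apply: linear_syn_perm => //= g.
    by rewrite /linear_key !key3 /swap23_nf /key23 minnC maxnC orbC.
  rewrite inE => /predU1P[->|].
    apply: linear_syn_perm => // g.
    by apply: linear_key_perm; first exact: perm_map.
  apply: linear_syn_zero => //= g.
  by rewrite /linear_key !key3 /swap23_nf eqxx.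
split.
  apply: (modular_key K) => [S VS|S VS a b c|S VS f i j k|i j k i' j' k'].
  - exact: permutative_swap23 (H S VS) (H4 S VS).
  - by rewrite (Z S VS _ _ _).2; apply: Z.
  - rewrite /swap23_nf; case: eqVneq => [-> _|_ /=]; first exact: Z.
    by case: eqVneq => // -> _; rewrite (H S VS); apply: Z.
  - exact: swap23_nf_perm.
(* Here G is generated by (2 3), which conjugates (1 2) into (1 3). *)
apply: (@not_cancellable V swap23_nf key12 key13 1 0 2 2 1 0 K) => //.
- move=> S VS; have h := H S VS; split=> E f.
    have e a b c : a * b * c = b * a * c := E (nth a [:: a; b; c]).
    by rewrite [LHS]h [LHS]e [LHS]h.
  have e a b c : a * b * c = c * b * a := E (nth a [:: a; b; c]).
  by rewrite [LHS]h [LHS]e [LHS]h.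
- by move=> g; rewrite /key12 minnC maxnC.
- by move=> g; rewrite /key13 minnC maxnC.
- exact: swap23_nf_separated.
Qed.

End Varieties.

Theorem mainTheorem2 :
  let x := letter 0 in
  let y := letter 1 in
  let z := letter 2 in
  let t := letter 3 in
  forall V : SEM,
    [\/ V = defined_by
              [:: x * y * z ≈ z * y * x & zero_identities (x * x * y)],
        V = defined_by
              [:: x * y * z ≈ y * z * x & zero_identities (x * x * y)],
        V = defined_by
              [:: x * y * z ≈ y * x * z,
                  x * y * z * t ≈ x * z * t * y
                & zero_identities (x * y * y)]
      | V = defined_by
              [:: x * y * z ≈ x * z * y,
                  x * y * z * t ≈ y * z * x * t
                & zero_identities (x * x * y)]] ->
    modular V /\ ~ cancellable V.
Proof.
move=> x y z t V [] VE.
- exact: reverse_variety.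
- exact: rotate_variety.
- exact: swap12_variety.
- exact: swap23_variety.
Qed.
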